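(* Let $m\ge 2$. Consider an $m$-strategy CR game with $c$ conformists and $r$ rebels ($c,r\ge1$) on the complete bipartite network whose two sides are the set of conformists and the set of rebels (so the edges are exactly all conformist–rebel pairs). The game admits a pure strategy Nash equilibrium (PNE) if and only if $m\mid c$ and $m\mid r$. In addition, at any PNE, conformists and rebels are each evenly distributed across the $m$ strategies, i.e. each strategy is chosen by exactly $c/m$ conformists and exactly $r/m$ rebels.
   Context: An $m$-strategy CR game consists of a finite set of players $N=C\cup R$ (disjoint union of conformists $C$ and rebels $R$), a set $E\neq\emptyset$ of undirected edges on $N$ without loops, and a strategy set $A=\{a_1,\dots,a_m\}$ common to all players. $N_i=\{j: ij\in E\}$ is the set of neighbors of $i$. For a strategy profile $\boldsymbol x\in A^N$, payoffs are $u_i(\boldsymbol x)=|\{j\in N_i: x_j=x_i\}|$ for $i\in C$ and $u_i(\boldsymbol x)=|\{j\in N_i: x_j\ne x_i\}|$ for $i\in R$. A profile $\boldsymbol x^*$ is a PNE if $u_i(\boldsymbol x^* )\ge u_i(x_i,\boldsymbol x^*_{-i})$ for all $i\in N$ and all $x_i\in A$. *)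

(* Defs.v *)
From mathcomp Require Import all_boot.

Set Implicit Arguments.
Unset Strict Implicit.
Unset Printing Implicit Defensive.

(* [edge i j] holds iff ij is an undirected edge; the rebels are the players
   outside [conformists], so the players are their disjoint union. *)
Record CRgame := {
  player : finType;
  conformists : {set player};
  edge : rel player;
  edge_sym : symmetric edge;
  edge_irrefl : irreflexive edge;
  edge_nonempty : exists i j : player, edge i j;
  strategy : finType
}.

Definition rebels (G : CRgame) : {set player G} := ~: conformists G.

Definition neighbors (G : CRgame) (i : player G) : {set player G} :=
  [set j | edge i j].

Definition profile (G : CRgame) := {ffun player G -> strategy G}.

Definition payoff (G : CRgame) (x : profile G) (i : player G) : nat :=
  if i \in conformists G then #|[set j in neighbors i | x j == x i]|
  else #|[set j in neighbors i | x j != x i]|.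

Definition deviate (G : CRgame) (x : profile G) (i : player G)
    (a : strategy G) : profile G :=
  [ffun j => if j == i then a else x j].

Definition PNE (G : CRgame) (x : profile G) : Prop :=
  forall (i : player G) (a : strategy G),
    payoff (deviate x i a) i <= payoff x i.

Definition complete_bipartite_CR (G : CRgame) : Prop :=
  forall i j : player G,
    edge i j <-> (i \in conformists G /\ j \in rebels G) \/
                 (i \in rebels G /\ j \in conformists G).

(* Main.v *)
Require Import Defs.
From mathcomp Require Import all_boot.

(** For a strategy a let C_a and R_a be the numbers of conformists and rebels
    choosing a.  On the complete bipartite network, x is a PNE iff every a with
    C_a > 0 maximises R and every a with R_a > 0 minimises C.  Pick a with
    C_a > 0: then R_a is the maximum of R, hence positive since there are rebels,
    so C_a is the minimum of C and every strategy is used by a conformist.  Thus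
    R is constant and positive, which in turn makes C constant. *)

(** With [q] the quotient, [D] and [A * 'I_q] have the same cardinality, so matching their
    enumerations gives a bijection; [f] is its first component. *)
Lemma even_distribution (T A : finType) (D : {set T}) :
  0 < #|D| -> #|A| %| #|D| ->
  exists f : T -> A, forall a, #|[set i in D | f i == a]| = #|D| %/ #|A|.
Proof.
move=> /card_gt0P[i0 Di0] /dvdnP[q eD].
have A_gt0 : 0 < #|A|.
  by rewrite lt0n; apply: contraTneq Di0 => A0; rewrite A0 muln0 in eD;
     rewrite (cards0_eq eD) inE.
rewrite eD mulnK //.
have e : #|{: A * 'I_q}| = #|D| by rewrite card_prod card_ord eD mulnC.
pose g p := enum_val (cast_ord e (enum_rank p)).
pose h i := enum_val (cast_ord (esym e) (enum_rank_in Di0 i)).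
have gD p : g p \in D by exact: enum_valP.
have gK : cancel g h.
  by move=> p; rewrite /g /h enum_valK_in cast_ordK enum_rankK.
have hK : {in D, cancel h g}.
  by move=> i Di; rewrite /g /h enum_valK cast_ordKV enum_rankK_in.
exists (fun i => (h i).1) => a.
(* The fiber over [a] is the image under the injection [g] of the [q] pairs with first component
   [a]. *)
have -> : [set i in D | (h i).1 == a] = (fun k => g (a, k)) @: [set: 'I_q].
  apply/setP=> i; rewrite inE; apply/andP/imsetP => [[Di /eqP<-]|[k _ ->]].
    by exists (h i).2; rewrite // -surjective_pairing hK.
  by rewrite gK gD.
rewrite card_imset ?cardsT ?card_ord // => k l /(can_inj gK).
by case.
Qed.

Lemma sum_fibers (T A : finType) (D : {set T}) (x : T -> A) :
  \sum_a #|[set i in D | x i == a]| = #|D|.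
Proof.
rewrite -sum1_card (partition_big x predT) //=.
by apply: eq_bigr => a _; rewrite -sum1_card; apply: eq_bigl => i; rewrite inE.
Qed.

Section CompleteBipartite.

Variables (G : CRgame) (hE : complete_bipartite_CR G).

Definition nconf (x : profile G) a := #|[set i in conformists G | x i == a]|.
Definition nreb (x : profile G) a := #|[set i in rebels G | x i == a]|.

Lemma neighbors_conformist i :
  i \in conformists G -> neighbors i = rebels G.
Proof.
move=> Ci; apply/setP=> j; rewrite inE; apply/idP/idP => [/hE|Rj].
  by rewrite !inE Ci => -[[_ ->]|[]].
by apply/hE; left.
Qed.

Lemma neighbors_rebel i : i \in rebels G -> neighbors i = conformists G.
Proof.
move=> Ri; apply/setP=> j; rewrite inE; apply/idP/idP => [/hE|Cj].
  by move: Ri; rewrite !inE => /negPf-> [[]|[_ ->]].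
by apply/hE; right.
Qed.

Lemma payoff_conformist x i :
  i \in conformists G -> payoff x i = nreb x (x i).
Proof. by move=> Ci; rewrite /payoff Ci neighbors_conformist. Qed.

Lemma payoff_rebel x i :
  i \in rebels G -> payoff x i = #|conformists G| - nconf x (x i).
Proof.
move=> Ri; have := Ri; rewrite inE /payoff => /negPf->.
(* Removing the fiber of [x i] from the total leaves the disagreeing conformists, partitioned by the
   strategies other than [x i]. *)
rewrite neighbors_rebel // -(sum_fibers _ _ (conformists G) x) (bigD1 (x i)) //=.
rewrite /nconf addKn -sum1_card.
rewrite (partition_big x (predC1 (x i))) => [|j]; last first.
  by rewrite inE => /andP[].
apply: eq_bigr => a /= a_neq; rewrite -sum1_card; apply: eq_bigl => j.
by rewrite !inE -andbA; case: (eqVneq (x j) a) => [->|_]; rewrite ?andbF ?a_neq.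
Qed.

(** The mover is not a rebel, so the move leaves every rebel count as it was under [x]. *)
Lemma payoff_deviate_conformist x i a :
  i \in conformists G -> payoff (deviate x i a) i = nreb x a.
Proof.
move=> Ci; rewrite payoff_conformist // [deviate _ _ _ i]ffunE eqxx /nreb.
apply: eq_card => j; rewrite !inE ffunE.
by case: (eqVneq j i) => [->|//]; rewrite Ci.
Qed.

Lemma payoff_deviate_rebel x i a :
  i \in rebels G ->
  payoff (deviate x i a) i = #|conformists G| - nconf x a.
Proof.
move=> Ri; rewrite payoff_rebel // [deviate _ _ _ i]ffunE eqxx /nconf.
congr (_ - _); apply: eq_card => j; rewrite !inE ffunE.
by case: (eqVneq j i) => [->|//]; move: Ri; rewrite inE => /negPf->.
Qed.

Lemma nconf_le x a : nconf x a <= #|conformists G|.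
Proof. by apply/subset_leq_card/subsetP=> i; rewrite inE => /andP[]. Qed.

(** A positive count supplies a player using [a], whose deviation to [b] yields the inequality;
    conversely, each player makes the count of its own strategy positive. *)
Lemma PNE_counts x :
  PNE x <->
  (forall a b, 0 < nconf x a -> nreb x b <= nreb x a) /\
  (forall a b, 0 < nreb x a -> nconf x a <= nconf x b).
Proof.
split=> [P|[PC PR] i a].
  split=> a b /card_gt0P[i]; rewrite inE => /andP[Di /eqP<-]; have := P i b.
    by rewrite payoff_deviate_conformist // payoff_conformist.
  (* Truncated subtraction can be cancelled here because [nconf] never exceeds the number of
     conformists. *)
  by rewrite payoff_deviate_rebel // payoff_rebel // leq_sub2lE // nconf_le.
have [Ci|nCi] := boolP (i \in conformists G).
  rewrite payoff_deviate_conformist // payoff_conformist //; apply: PC.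
  by apply/card_gt0P; exists i; rewrite inE Ci /=.
have Ri : i \in rebels G by rewrite inE.
rewrite payoff_deviate_rebel // payoff_rebel // leq_sub2l //; apply: PR.
by apply/card_gt0P; exists i; rewrite inE Ri /=.
Qed.

(** The product form yields both divisibility and the exact quotient. *)
Lemma PNE_even x a :
  0 < #|conformists G| -> 0 < #|rebels G| -> PNE x ->
  #|conformists G| = #|strategy G| * nconf x a /\
  #|rebels G| = #|strategy G| * nreb x a.
Proof.
move=> /card_gt0P[i Ci] /card_gt0P[j Rj] /PNE_counts[PC PR].
have Ci_gt0 : 0 < nconf x (x i).
  by apply/card_gt0P; exists i; rewrite inE Ci /=.
have Rj_gt0 : 0 < nreb x (x j).
  by apply/card_gt0P; exists j; rewrite inE Rj /=.
have Ri_gt0 : 0 < nreb x (x i) := leq_trans Rj_gt0 (PC _ (x j) Ci_gt0).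
have C_gt0 b : 0 < nconf x b := leq_trans Ci_gt0 (PR _ b Ri_gt0).
have R_gt0 b : 0 < nreb x b := leq_trans Ri_gt0 (PC _ (x i) (C_gt0 b)).
(* All strategies are used on both sides, so each inequality also holds with [a] and [b] swapped,
   and every fiber has the size of that of [a]. *)
split; rewrite -(sum_fibers _ _ _ x) -sum_nat_const; apply: eq_bigr => b _.
  by apply/eqP; rewrite eqn_leq !PR.
by apply/eqP; rewrite eqn_leq !PC.
Qed.

(** Spreading each side evenly makes both counts constant, so the inequalities of [PNE_counts]
    become equalities. *)
Lemma exists_PNE :
  0 < #|conformists G| -> 0 < #|rebels G| ->
  #|strategy G| %| #|conformists G| -> #|strategy G| %| #|rebels G| ->
  exists x : profile G, PNE x.
Proof.
move=> C_gt0 R_gt0 mC mR.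
have [f hf] := even_distribution _ _ _ C_gt0 mC.
have [g hg] := even_distribution _ _ _ R_gt0 mR.
pose x : profile G := [ffun i => if i \in conformists G then f i else g i].
have xC a : nconf x a = #|conformists G| %/ #|strategy G|.
  rewrite -(hf a); apply: eq_card => i; rewrite !inE ffunE.
  by case: (i \in conformists G).
have xR a : nreb x a = #|rebels G| %/ #|strategy G|.
  rewrite -(hg a); apply: eq_card => i; rewrite !inE ffunE.
  by case: (i \in conformists G).
by exists x; apply/PNE_counts; split=> a b _; rewrite ?xC ?xR.
Qed.

End CompleteBipartite.

Theorem mainTheorem7 (m c r : nat) (G : CRgame)
  (hm : 2 <= m) (hc : 1 <= c) (hr : 1 <= r)
  (hA : #|strategy G| = m)
  (hC : #|conformists G| = c)
  (hR : #|rebels G| = r)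
  (hE : complete_bipartite_CR G) :
  ((exists x : profile G, PNE x) <-> (m %| c) /\ (m %| r)) /\
  (forall x : profile G, PNE x ->
     forall a : strategy G,
       #|[set i in conformists G | x i == a]| = c %/ m /\
       #|[set i in rebels G | x i == a]| = r %/ m).
Proof.
subst m c r; have A_gt0 := ltnW hm.
split; [split=> [[x xP]|[mC mR]] | move=> x xP a].
- have /card_gt0P[a _] := A_gt0.
  by have [-> ->] := PNE_even _ hE x a hc hr xP; rewrite !dvdn_mulr.
- exact: exists_PNE.
- have [-> ->] := PNE_even _ hE x a hc hr xP.
  by rewrite !mulKn.
Qed.
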